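(* If a graph $G$ is Hamiltonian, then the exponential graph $G^{K_2}$ is Hamiltonian.
   Context: A graph means a finite simple undirected graph with at least one vertex. A cycle has length at least 3; a Hamiltonian cycle is a cycle containing every vertex, and a graph is Hamiltonian if it has a Hamiltonian cycle (so it has at least 3 vertices). $K_2$ is the complete graph on two vertices. Exponential graph: for graphs $G$ and $H$ with $V(H)=\{w_1,\ldots,w_q\}$, the exponential graph $G^H$ has vertex set $\{(u_1,\ldots,u_q;w_j) : u_i\in V(G)\ (1\le i\le q),\ 1\le j\le q\}$, and two vertices $(u_1,\ldots,u_q;w_j)$ and $(v_1,\ldots,v_q;w_k)$ are adjacent if and only if either ($j=k$, $u_jv_j\in E(G)$, and $u_i=v_i$ for all $i\ne j$) or ($j\neq k$, $w_jw_k\in E(H)$, and $u_i=v_i$ for all $i$). *)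

(* Defs.v *)
From HB Require Import structures.
From mathcomp Require Import all_boot.

Set Implicit Arguments.
Unset Strict Implicit.
Unset Printing Implicit Defensive.

Record sgraph := SGraph {
  vertex :> finType;
  edge : rel vertex;
  edge_sym : symmetric edge;
  edge_irrefl : irreflexive edge;
  vertex_gt0 : 0 < #|vertex|
}.

Arguments edge {s}.

(* A cycle is given by the list of its vertices in cyclic order. The bound on
   the size excludes [::] and [:: x; y], for which [cycle edge c] can hold. *)
Definition is_cycle (G : sgraph) (c : seq G) : bool :=
  [&& 2 < size c, uniq c & cycle edge c].

Definition hamiltonian (G : sgraph) : Prop :=
  exists c : seq G, is_cycle c /\ forall v : G, v \in c.

Section ExponentialGraph.
Variables G H : sgraph.

(* The coordinates u_1, ..., u_q are indexed by the vertices w_1, ..., w_q of H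
   themselves: the vertex (u_1, ..., u_q; w_j) is the pair (u, w) with w = w_j
   and u w_i = u_i. *)
Definition exp_vertex : finType := ({ffun H -> G} * H)%type.

Definition exp_edge : rel exp_vertex := fun x y =>
  let: (u, w) := x in
  let: (v, z) := y in
  [&& w == z, edge (u w) (v w) & [forall i : H, (i != w) ==> (u i == v i)]]
  || [&& w != z, edge w z & [forall i : H, u i == v i]].

Lemma exp_edge_sym : symmetric exp_edge.
Proof.
move=> [u w] [v z]; rewrite /exp_edge; congr (_ || _).
  rewrite [z == w]eq_sym; case: eqP => //= <-.
  rewrite edge_sym; congr (_ && _).
  by apply: eq_forallb => i; rewrite [u i == _]eq_sym.
rewrite [z == w]eq_sym edge_sym; congr [&& _, _ & _].
by apply: eq_forallb => i; rewrite [u i == _]eq_sym.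
Qed.

Lemma exp_edge_irrefl : irreflexive exp_edge.
Proof. by move=> [u w]; rewrite /exp_edge eqxx !edge_irrefl. Qed.

Lemma exp_vertex_gt0 : 0 < #|exp_vertex|.
Proof. by rewrite card_prod card_ffun muln_gt0 expn_gt0 !vertex_gt0. Qed.

Definition exp_graph : sgraph :=
  SGraph exp_edge_sym exp_edge_irrefl exp_vertex_gt0.

End ExponentialGraph.

Definition K2_edge : rel 'I_2 := fun i j => i != j.

Lemma K2_edge_sym : symmetric K2_edge.
Proof. by move=> i j; rewrite /K2_edge eq_sym. Qed.

Lemma K2_edge_irrefl : irreflexive K2_edge.
Proof. by move=> i; rewrite /K2_edge eqxx. Qed.

Lemma K2_vertex_gt0 : 0 < #|'I_2|.
Proof. by rewrite card_ord. Qed.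

Definition K2 : sgraph := SGraph K2_edge_sym K2_edge_irrefl K2_vertex_gt0.

(* Main.v *)
Require Import Defs.
From mathcomp Require Import all_boot.

(** Fix a cyclic order [s] of the vertices of [G] along a Hamiltonian cycle. In
    the layer [w_1] the rows [{(u, v; w_1) | u}] are cycles, in the layer [w_2]
    the columns [{(u, v; w_2) | v}] are, and the two layers are joined by a
    perfect matching. Start at [(v, v; w_1)], run through the whole row up to
    [(s^-1 v, v; w_1)], cross to [(s^-1 v, v; w_2)], run through the whole
    column up to [(s^-1 v, s^-1 v; w_2)] and cross back to
    [(s^-1 v, s^-1 v; w_1)]. Repeating this visits every row and every column
    exactly once. *)

Set Implicit Arguments.
Unset Strict Implicit.
Unset Printing Implicit Defensive.

Lemma hamiltonian_succ (G : sgraph) : hamiltonian G ->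
  2 < #|G| /\ exists s : G -> G,
    [/\ injective s, forall x, edge x (s x) & forall x y, fconnect s x y].
Proof.
move=> [c [/and3P[c_gt2 Uc Ec] c_full]]; split.
  by rewrite -(card_uniqP Uc) in c_gt2; apply: leq_trans c_gt2 (max_card _).
exists (next c); split=> [|x|x y].
- exact: can_inj (prev_next Uc).
- exact: next_cycle Ec (c_full x).
- by rewrite (fconnect_cycle (cycle_next Uc)).
Qed.

(** The single orbit of [f], carried over by [phi], is the cycle. The separate type [T] allows [f]
    to be defined on triples instead of finite functions. *)
Lemma succ_hamiltonian (G : sgraph) (T : finType) (phi : T -> G) (f : T -> T)
    (x0 : T) :
    injective phi -> (forall g, exists x, g = phi x) ->
    injective f -> (forall x, edge (phi x) (phi (f x))) ->
    (forall x, fconnect f x0 x) -> 2 < #|T| ->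
  hamiltonian G.
Proof.
move=> phi_inj phi_surj f_inj Ef f_conn T_gt2.
exists (map phi (orbit f x0)); split; last first.
  by move=> g; have [x ->] := phi_surj g; rewrite map_f // -fconnect_orbit.
apply/and3P; split.
- by rewrite size_map size_orbit /order (eq_card (B := T)) // => x; apply: f_conn.
- by rewrite map_inj_uniq // orbit_uniq.
- rewrite cycle_map; apply: sub_cycle (cycle_orbit f_inj x0) => x y /eqP <- /=.
  exact: Ef.
Qed.

Section SpiralSuccessor.
Variables (T : finType) (s : T -> T).
Hypotheses (s_inj : injective s) (s_conn : forall x y, fconnect s x y).

(** The boolean is [false] in the layer $w_1$ and [true] in $w_2$. The two tests detect the end of a
    row and of a column. *)
Definition spiral (x : T * T * bool) : T * T * bool :=
  let: (u, v, b) := x in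
  if b then if u == v then (u, v, false) else (u, s v, true)
  else if s u == v then (u, v, true) else (s u, v, false).

(** Only a move and a crossing into the same layer could collide. A column move onto
    [(u, s u, true)] would have to start at [(u, u, true)], where [spiral] crosses instead; rows are
    similar. *)
Lemma spiral_inj : injective spiral.
Proof.
move=> [[u v] [|]] [[u' v'] [|]] /=;
  case: eqP => [e1|n1]; case: eqP => [e2|n2] // [] eu ev; try congruence.
- by rewrite eu (s_inj ev).
- by case: n1; apply: s_inj; rewrite ev eu.
- by case: n2; apply: s_inj; rewrite -ev -eu.
- by rewrite (s_inj eu) ev.
Qed.

Lemma succ_ind (x : T) (P : T -> Prop) :
  P x -> (forall y, P y -> P (s y)) -> forall y, P y.
Proof.
move=> Px Ps y; rewrite -(iter_findex (s_conn x y)).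
by elim: (findex _ _ _) => //= n; apply: Ps.
Qed.

Lemma spiral_row v u : fconnect spiral (v, v, false) (u, v, false).
Proof.
elim/(@succ_ind v): u => // u IH.
(* If [s u = v], the row has closed up and the target is its starting point. *)
have [-> //|ne] := eqVneq (s u) v.
by apply: connect_trans IH (connect1 _); rewrite /= (negPf ne).
Qed.

(** The row of [s u] ends at [(u, s u)]; crossing there enters the column of [u] at height [s u],
    from which the induction along [s] starts. *)
Lemma spiral_column u v :
  fconnect spiral (s u, s u, false) (u, v, true).
Proof.
have enter : fconnect spiral (s u, s u, false) (u, s u, true).
  by apply: connect_trans (spiral_row (s u) u) (connect1 _); rewrite /= eqxx.
elim/(@succ_ind (s u)): v => // v IH.
have [<- //|ne] := eqVneq u v.
by apply: connect_trans IH (connect1 _); rewrite /= (negPf ne).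
Qed.

Lemma spiral_diag u v : fconnect spiral (u, u, false) (v, v, false).
Proof.
elim/(@succ_ind u): v => // v IH.
(* One round leads from the diagonal point of [s v] back to that of [v], against the direction of
   the induction, hence the symmetry. *)
apply: connect_trans IH _; rewrite (fconnect_sym spiral_inj).
by apply: connect_trans (spiral_column v v) (connect1 _); rewrite /= eqxx.
Qed.

Lemma spiral_connect u x : fconnect spiral (u, u, false) x.
Proof.
case: x => [[v w] [|]].
  exact: connect_trans (spiral_diag u (s v)) (spiral_column v w).
exact: connect_trans (spiral_diag u w) (spiral_row w v).
Qed.

End SpiralSuccessor.

Section ExponentialK2.
Variable G : sgraph.

Definition exp_K2_vertex (x : G * G * bool) : exp_graph G K2 :=
  let: (u, v, b) := x in
  ([ffun i : 'I_2 => if i == ord0 then u else v], if b then ord_max else ord0).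

Lemma exp_K2_vertex_inj : injective exp_K2_vertex.
Proof.
move=> [[u v] b] [[u' v'] b'] [/ffunP e eb].
have := e ord_max; have := e ord0; rewrite !ffunE /= => -> ->.
by case: b b' eb => [] [].
Qed.

Lemma exp_K2_vertex_surj x : exists y, x = exp_K2_vertex y.
Proof.
case: x => h j; exists (h ord0, h ord_max, j != ord0 :> 'I_2).
congr pair; last by case: j => [[|[|]]] // j2; apply: val_inj.
apply/ffunP=> i; rewrite ffunE.
by case: eqP => [-> //|]; case: i => [[|[|]]] // i2 ne;
  [case: ne|congr (h _)]; apply: val_inj.
Qed.

Lemma spiral_edge (s : G -> G) : (forall x, edge x (s x)) ->
  forall x, edge (exp_K2_vertex x) (exp_K2_vertex (spiral s x)).
Proof.
move=> Es [[u v] [|]] /=; case: ifP => _; rewrite /exp_edge /= ?eqxx //=.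
- by apply/forallP=> i; rewrite !ffunE.
(* A column move in the layer [ord_max] changes the coordinate [ord_max] only. *)
- rewrite !ffunE /= Es /= orbF; apply/forallP=> -[[|[|]] // i2].
  by rewrite !ffunE /= ?eqxx ?implybT.
- by apply/forallP=> i; rewrite !ffunE.
- rewrite !ffunE /= Es /= orbF; apply/forallP=> -[[|[|]] // i2].
  by rewrite !ffunE /= ?eqxx ?implybT.
Qed.

End ExponentialK2.

Theorem theorem7 (G : sgraph) (hG : hamiltonian G) :
  hamiltonian (exp_graph G K2).
Proof.
have [G_gt2 [s [s_inj Es s_conn]]] := hamiltonian_succ hG.
have /card_gt0P[x0 _] := vertex_gt0 G.
apply: (succ_hamiltonian (x0 := (x0, x0, false)) (@exp_K2_vertex_inj G)
  (@exp_K2_vertex_surj G) (spiral_inj s_inj) (spiral_edge Es)).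
  exact: spiral_connect.
rewrite !card_prod card_bool (leq_trans G_gt2) // -mulnA leq_pmulr //.
by rewrite muln_gt0 vertex_gt0.
Qed.
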